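(* Let $0 \leq \sigma < 1$ and $2 \leq \kappa < 1 + \frac{2}{\sigma}$ (with the convention $\frac{2}{0} = +\infty$). Suppose $\alpha \in \mathbb{R}$ is Diophantine of type $\kappa$. Then the sequence $\{\alpha n^2\}_{n}$ exhibits $\sigma$-pair correlation, that is, for every interval $[a,b]$, \[ \mathrm{R}_2^\sigma([a,b], \{\alpha n^2\}_n, N) \to b-a \quad \text{as } N \to \infty . \]
   Context: A real number $\alpha$ is Diophantine of type $\kappa$ if there is a constant $c>0$ such that $|\alpha - p/q| \geq c/q^{\kappa}$ for all $p \in \mathbb{Z}$ and all integers $q \geq 1$. For a real sequence $\{\theta_n\}_n$, $0 \leq \sigma < 2$, an interval $[a,b]$ and $N \in \mathbb{N}$, define \[ \mathrm{R}_2^\sigma([a,b], \{\theta_n\}_n, N) = \frac{1}{N^{2-\sigma}} \#\Big\{ 1 \leq j \neq k \leq N \;\Big|\; \theta_j - \theta_k \in \Big[\frac{a}{N^\sigma}, \frac{b}{N^\sigma}\Big] + \mathbb{Z} \Big\}. \] The sequence exhibits $\sigma$-pair correlation if $\mathrm{R}_2^\sigma([a,b],\{\theta_n\}_n,N) \to b-a$ as $N\to\infty$ for all intervals $[a,b]$.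
   Formalization: For σ = 0 only intervals with b − a ≤ 1 are considered, since for σ = 0 and b − a > 1 the set [a,b] + ℤ is the whole line, so R_2 tends to 1 ≠ b − a for every sequence; nothing is changed for σ > 0. *)

(* Defs.v *)
From mathcomp Require Import all_boot all_order all_algebra.
From mathcomp Require Import all_classical all_reals all_analysis.

Set Implicit Arguments.
Unset Strict Implicit.
Unset Printing Implicit Defensive.

Import Order.TTheory GRing.Theory Num.Theory.
Import numFieldNormedType.Exports.

Local Open Scope classical_set_scope.
Local Open Scope ring_scope.

Definition diophantine (R : realType) (kappa alpha : R) : Prop :=
  exists2 c : R, 0 < c &
    forall (p : int) (q : nat), (1 <= q)%N ->
      c / q%:R `^ kappa <= `|alpha - p%:~R / q%:R|.

Definition itv_modZ (R : realType) (u v : R) : set R :=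
  [set x + m%:~R | x in `[u, v] & m in [set: int]].

(* Sequences are indexed from 1: the ordinal i < N stands for the index i + 1,
   and the value theta 0 is never used. *)
Definition pair_count (R : realType) (sigma a b : R) (theta : nat -> R)
    (N : nat) : nat :=
  #|[set jk : 'I_N * 'I_N | (jk.1 != jk.2) &&
      (theta jk.1.+1 - theta jk.2.+1
         \in itv_modZ (a / N%:R `^ sigma) (b / N%:R `^ sigma))]%SET|.

Definition R2 (R : realType) (sigma a b : R) (theta : nat -> R) (N : nat) : R :=
  (N%:R `^ (2 - sigma))^-1 * (pair_count sigma a b theta N)%:R.

(* For sigma = 0 the interval [a, b] is not rescaled, so [a, b] + Z is the
   whole line as soon as b - a >= 1 and R2 = (N^2 - N) / N^2 tends to 1
   whatever the sequence; the limit b - a is thus only meaningful for intervals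
   of length at most 1, i.e. for arcs of R/Z.  For sigma > 0 there is no
   restriction on the interval. *)
Definition exhibits_pair_correlation (R : realType) (sigma : R)
    (theta : nat -> R) : Prop :=
  forall a b : R, a <= b -> (sigma = 0 -> b - a <= 1) ->
    R2 sigma a b theta N @[N --> \oo] --> b - a.

(* Main.v *)
Require Import Defs.
From mathcomp Require Import all_boot all_order all_algebra.
From mathcomp Require Import all_classical all_reals all_analysis.
From mathcomp Require Import ring lra zify.

Set Implicit Arguments.
Unset Strict Implicit.
Unset Printing Implicit Defensive.

Import Order.TTheory GRing.Theory Num.Theory.
Import numFieldNormedType.Exports.

Local Open Scope classical_set_scope.
Local Open Scope ring_scope.

(* For a fixed difference h = j - k, the numbers alpha (j^2 - k^2) form an
   arithmetic progression in k with common difference 2 alpha h.  Dirichlet's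
   theorem gives r <= N^(1 - e) with d := ||2 alpha h r|| small; blocks of
   length r are equidistributed up to O(1) points, so an arc of length L ~
   N^(-sigma) is hit with error O(N / r + r L), which is negligible unless
   r <= N^e / L.  For such small r the error is still at most
   N^e (min(N / r, L / d) + 1), because the residue classes modulo r drift
   through the arc at speed d / r per step.  These errors are summed over
   n = h r, every n occurring at most N^e times by the divisor bound; when 2 alpha
   has a convergent p / q with N^(sigma + 6 e) << q <= N^(2 - 4 e), the points
   2 alpha n are well spaced in blocks of length q, and the sum is
   O(N^(2 - sigma - e)).  Such a q exists by the Diophantine condition, exactly
   because (kappa - 1) sigma < 2. *)

(** * Integer-valued counting *)

Lemma itv_modZP (R : realType) (u v x : R) :
  reflect (exists m : int, u <= x - m%:~R <= v) (x \in itv_modZ u v).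
Proof.
apply: (iffP idP).
  rewrite inE => -[y /=]; rewrite in_itv /= => yuv [m _ <-].
  by exists m; rewrite addrK.
move=> [m xm]; rewrite inE; exists (x - m%:~R); first by rewrite /= in_itv.
by exists m => //; rewrite subrK.
Qed.

Lemma natr_card (R : realType) (T : finType) (P : pred T) :
  \sum_(i : T) (P i)%:R = #|P|%:R :> R.
Proof.
rewrite -sum1_card natr_sum [RHS]big_mkcond /=.
by apply: eq_bigr => i _; rewrite unfold_in; case: (P i).
Qed.

(** An interval of length [y - x] contains at most [y - x + 1] integers, and each fibre of [g] over
    one of them has size at most [M]. *)
Lemma card_fibers_le (R : realType) (T : finType) (P : pred T) (g : T -> int)
    (x y M : R) :
  x <= y -> 0 <= M -> (forall i, P i -> x <= (g i)%:~R <= y) ->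
  (forall c : int, #|[pred i | P i && (g i == c)]|%:R <= M) ->
  #|P|%:R <= (y - x + 1) * M.
Proof.
move=> lexy M0 gxy fib; pose n := `|(Num.floor y - Num.ceil x + 1)%R|%N.
pose S := [seq Num.ceil x + i%:Z | i <- iota 0 n].
have [fy1 fy2] := andP (floor_itv y); have [cx1 cx2] := andP (ceil_itv x).
rewrite !rmorphD /= in fy2 cx1.
(* The absolute value in [n] is harmless: [ceil x <= floor y + 1] even when [[x, y]] contains no
   integer. *)
have nE : n%:Z = Num.floor y - Num.ceil x + 1.
  apply: gez0_abs; suff : Num.ceil x <= Num.floor y + 1 by lia.
  by rewrite ceil_le_int rmorphD /=; lra.
have nle : n%:R <= y - x + 1.
  by rewrite pmulrn nE rmorphD rmorphB /=; lra.
have sumS i : P i -> (1 <= \sum_(c <- S) (g i == c))%N.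
  move=> Pi; have /andP[gx gy] := gxy _ Pi.
  have gS : g i \in S.
    rewrite -ceil_le_int in gx; rewrite -floor_ge_int in gy.
    have g0 : 0 <= g i - Num.ceil x by rewrite subr_ge0.
    apply/mapP; exists `|(g i - Num.ceil x)%R|%N; last first.
      by rewrite gez0_abs// addrC subrK.
    rewrite mem_iota /= add0n -ltz_nat gez0_abs// nE ltzD1.
    by rewrite lerD2r.
  by rewrite (big_rem _ gS) /= eqxx.
have -> : #|P|%:R = \sum_(i | P i) 1 :> R by rewrite -sum1_card natr_sum.
have le1 : \sum_(i | P i) 1 <= \sum_(i | P i) \sum_(c <- S) (g i == c)%:R :> R.
  by apply: ler_sum => i Pi; rewrite -natr_sum ler1n; exact: sumS.
apply: (le_trans le1); rewrite exchange_big /=.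
apply: (@le_trans _ _ (\sum_(c <- S) M)).
  apply: ler_sum => c _; apply: le_trans (fib c).
  rewrite -natr_card big_mkcond /=; apply: ler_sum => i _.
  by case: (P i).
rewrite big_const_seq count_predT size_map size_iota iter_addr_0 -mulr_natl.
exact: ler_wpM2r.
Qed.

Lemma card_int_inj_le (R : realType) (T : finType) (P : pred T) (g : T -> int)
    (x y : R) :
  x <= y -> (forall i, P i -> x <= (g i)%:~R <= y) ->
  (forall i j, P i -> P j -> g i = g j -> i = j) -> #|P|%:R <= y - x + 1.
Proof.
move=> xy gxy gI; rewrite -[leRHS]mulr1; apply: (card_fibers_le xy _ gxy) => // c.
rewrite lern1; apply/card_le1_eqP => i j /andP[Pi /eqP gi] /andP[Pj /eqP gj].
by apply: gI => //; rewrite gi gj.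
Qed.

(** * Arithmetic progressions modulo one *)

(** The largest integer [m] with [u <= x - m] is [floor (x - u)]; it makes [x - m] smallest, so only
    this [m] has to be tested against [v]. *)
Lemma itv_modZE (R : realType) (u v x : R) :
  (x \in itv_modZ u v) = (x - (Num.floor (x - u))%:~R <= v).
Proof.
have /andP[f1 f2] := floor_itv (x - u).
apply/itv_modZP/idP => [[m /andP[um mv]]|h]; last first.
  by exists (Num.floor (x - u)); rewrite h andbT; lra.
apply: le_trans mv; rewrite lerB// ler_int floor_ge_int; lra.
Qed.

Definition hits (R : realType) (beta gamma u v : R) (K : nat) : R :=
  \sum_(0 <= k < K) (beta * k%:R + gamma \in itv_modZ u v)%:R.

Section Hits.
Context {R : realType}.
Implicit Types (beta gamma u v : R) (a : int) (r K : nat).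

Lemma hits_card beta gamma u v K : hits beta gamma u v K =
  #|[pred k : 'I_K | beta * k%:R + gamma \in itv_modZ u v]|%:R.
Proof. by rewrite /hits big_mkord -natr_card; apply: eq_bigr. Qed.

Lemma hits_ge0 beta gamma u v K : 0 <= hits beta gamma u v K.
Proof. by apply: sumr_ge0. Qed.

Lemma hits_monotone beta gamma u v K K' : (K <= K')%N ->
  hits beta gamma u v K <= hits beta gamma u v K'.
Proof.
move=> KK'; rewrite /hits [leRHS](big_cat_nat (leq0n K) KK') /= lerDl; exact: sumr_ge0.
Qed.

Lemma hits_block beta gamma u v B r :
  hits beta gamma u v (B * r) =
  \sum_(0 <= i < B) hits beta (gamma + beta * (i * r)%:R) u v r.
Proof.
rewrite /hits big_nat_mul; apply: eq_bigr => i _.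
rewrite -{1}[(i * r)%N]add0n big_addn mulSn addnK.
apply: eq_bigr => k _; rewrite natrD mulrDr -addrA [_ + gamma]addrC.
by rewrite addrA.
Qed.

(** The arcs [[u, v]] and [[v, u + 1]] cover the circle. This turns upper bounds for [hits] into
    lower bounds. *)
Lemma hits_compl beta gamma u v K :
  K%:R <= hits beta gamma u v K + hits beta gamma v (u + 1) K.
Proof.
have -> : K%:R = \sum_(0 <= k < K) (1 : R) by rewrite sumr_const_nat subn0.
rewrite -big_split /=; apply: ler_sum => k _; rewrite -natrD ler1n addn_gt0 !lt0b.
set x := _ + gamma; have /andP[f1 f2] := floor_itv (x - u).
have [xv|xv] := leP (x - (Num.floor (x - u))%:~R) v.
  by apply/orP; left; rewrite itv_modZE.
apply/orP; right; apply/itv_modZP; exists (Num.floor (x - u)).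
by move: f2; rewrite rmorphD /=; lra.
Qed.

(* The numerators [a k - r z] of the points landing in [u, v] + z are distinct
   and lie in an interval of length [r (v - u) + 2]. *)
Lemma hits_block_le beta gamma u v a r : (0 < r)%N -> coprimez a r ->
  `|r%:R * beta - a%:~R| <= r%:R^-1 -> u <= v ->
  hits beta gamma u v r <= r%:R * (v - u) + 3.
Proof.
move=> r0 car d uv; rewrite hits_card.
have r0' : 0 < r%:R :> R by rewrite ltr0n.
pose z (k : 'I_r) := Num.floor (beta * k%:R + gamma - u).
have H : r%:R * u <= r%:R * v by rewrite ler_pM2l.
have := @card_int_inj_le R _ [pred k : 'I_r | beta * k%:R + gamma \in itv_modZ u v]
  (fun k => a * k%:Z - r%:Z * z k) (r%:R * (u - gamma) - 1) (r%:R * (v - gamma) + 1).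
have -> : r%:R * (v - gamma) + 1 - (r%:R * (u - gamma) - 1) + 1 = r%:R * (v - u) + 3.
  by ring.
apply; first lra.
  move=> k /=; rewrite itv_modZE -/(z k) => kv.
  have /andP[f1 f2] := floor_itv (beta * k%:R + gamma - u); rewrite -/(z k) in f1 f2.
  rewrite rmorphB !rmorphM /= -!pmulrn.
  have e : a%:~R * k%:R - r%:R * (z k)%:~R = r%:R * (beta * k%:R + gamma - (z k)%:~R)
     - r%:R * gamma - (r%:R * beta - a%:~R) * k%:R by ring.
  have k1 : k%:R <= r%:R :> R by rewrite ler_nat ltnW.
  (* As [k < r], the drift away from the multiples of [1 / r] costs at most 1 on either side. *)
  have dk : `|(r%:R * beta - a%:~R) * k%:R| <= 1.
    rewrite normrM (ger0_norm (ler0n _ _)).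
    by apply: le_trans (ler_pM _ _ d k1) _ => //; rewrite mulVf ?gt_eqF.
  move: dk; rewrite ler_norml => /andP[dk1 dk2].
  have l1 : r%:R * u <= r%:R * (beta * k%:R + gamma - (z k)%:~R).
    by rewrite ler_pM2l//; lra.
  have l2 : r%:R * (beta * k%:R + gamma - (z k)%:~R) <= r%:R * v by rewrite ler_pM2l.
  by rewrite e; lra.
move=> i j _ _ e; apply/ord_inj.
(* Equal numerators give [r | a (i - j)]; as [a] is prime to [r] and [|i - j| < r], this forces
   [i = j]. *)
have : (r%:Z %| a * (i%:Z - j%:Z))%Z.
  apply/dvdzP; exists (z i - z j); rewrite /= in e; move: (z i) (z j) e => x y e.
  have -> : a * (i%:Z - j%:Z) = a * j%:Z - r%:Z * y + r%:Z * x - a * j%:Z.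
    by rewrite -e subrK mulrBr.
  ring.
rewrite Gauss_dvdzr; last by rewrite coprimez_sym.
move=> /dvdzP[c]; move: (ltn_ord i) (ltn_ord j).
move: (nat_of_ord i) (nat_of_ord j) => x y.
by case: (ltgtP c 0) => [c0|c0|->]; nia.
Qed.

(** Apply the upper bound to the complementary arc, of length [1 - (v - u)]. *)
Lemma hits_block_ge beta gamma u v a r : (0 < r)%N -> coprimez a r ->
  `|r%:R * beta - a%:~R| <= r%:R^-1 -> v <= u + 1 ->
  r%:R * (v - u) - 3 <= hits beta gamma u v r.
Proof.
move=> r0 car d uv; have := hits_block_le gamma r0 car d uv.
by have := hits_compl beta gamma u v r; lra.
Qed.

Lemma hits_upper beta gamma u v a r B : (0 < r)%N -> coprimez a r ->
  `|r%:R * beta - a%:~R| <= r%:R^-1 -> u <= v ->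
  hits beta gamma u v (B * r) <= B%:R * (r%:R * (v - u) + 3).
Proof.
move=> r0 car d uv; rewrite hits_block.
have -> : B%:R * (r%:R * (v - u) + 3) = \sum_(0 <= i < B) (r%:R * (v - u) + 3).
  by rewrite sumr_const_nat subn0 mulr_natl.
by apply: ler_sum => i _; exact: hits_block_le car d uv.
Qed.

Lemma hits_lower beta gamma u v a r B : (0 < r)%N -> coprimez a r ->
  `|r%:R * beta - a%:~R| <= r%:R^-1 -> v <= u + 1 ->
  B%:R * (r%:R * (v - u) - 3) <= hits beta gamma u v (B * r).
Proof.
move=> r0 car d uv; rewrite hits_block.
have -> : B%:R * (r%:R * (v - u) - 3) = \sum_(0 <= i < B) (r%:R * (v - u) - 3).
  by rewrite sumr_const_nat subn0 mulr_natl.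
by apply: ler_sum => i _; exact: hits_block_ge car d uv.
Qed.

(** Squeeze [K] between consecutive multiples of [r]: a full block errs by at most 3, the incomplete
    one by at most [r (v - u) + 3]. *)
Lemma hits_discrepancy beta gamma u v a r K : (0 < r)%N -> coprimez a r ->
  `|r%:R * beta - a%:~R| <= r%:R^-1 -> u <= v -> v <= u + 1 ->
  `|hits beta gamma u v K - K%:R * (v - u)| <=
  r%:R * (v - u) + 3 * (K%:R / r%:R) + 3.
Proof.
move=> r0 car d uv vu; have r0' : 0 < r%:R :> R by rewrite ltr0n.
have up : hits beta gamma u v K <= _ :=
  le_trans (hits_monotone _ _ _ _ (ltnW (ltn_ceil K r0)))
    (hits_upper gamma (K %/ r).+1 r0 car d uv).
have lo : _ <= hits beta gamma u v K :=
  le_trans (hits_lower gamma (K %/ r) r0 car d vu)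
    (hits_monotone _ _ _ _ (leq_trunc_div K r)).
have q1 : (K %/ r)%:R * r%:R <= K%:R :> R by rewrite -natrM ler_nat leq_trunc_div.
have q2 : K%:R <= ((K %/ r)%:R + 1) * r%:R :> R.
  by rewrite natr1 -natrM ler_nat ltnW// ltn_ceil.
have q3 : (K %/ r)%:R <= K%:R / r%:R :> R by rewrite ler_pdivlMr.
rewrite -natr1 in up; move: (v - u) (subr_ge0 u v) up lo => L; rewrite uv => L0 up lo.
have q1' : (K %/ r)%:R * r%:R * L <= K%:R * L by exact: ler_wpM2r.
have q2' : K%:R * L <= ((K %/ r)%:R + 1) * r%:R * L by exact: ler_wpM2r.
rewrite ler_norml; apply/andP; split; nra.
Qed.

End Hits.

(** * Drift through an arc, and Dirichlet approximation *)

Section Drift.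
Context {R : realType}.
Implicit Types (beta gamma u v : R) (a : int) (r K : nat).

(* Each numerator [c = a k - r z] fixes [k] modulo [r] and, through the drift
   [(r beta - a) k], confines it to an interval of length
   [r (v - u) / `|r beta - a|]. *)
Lemma hits_drift_le beta gamma u v a r K : (0 < r)%N -> coprimez a r ->
  0 < `|r%:R * beta - a%:~R| -> u <= v ->
  hits beta gamma u v K <=
  (r%:R * (v - u) + 2 * (`|r%:R * beta - a%:~R| * K%:R) + 1) *
  (Num.min (K%:R / r%:R) ((v - u) / `|r%:R * beta - a%:~R|) + 1).
Proof.
move=> r0 car; set eta := r%:R * beta - a%:~R; set d := `|eta| => d0 uv.
have r0' : 0 < r%:R :> R by rewrite ltr0n.
have dE : - d <= eta <= d by rewrite -ler_norml.
set M := Num.min _ _.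
have M0 : 0 <= M by rewrite le_min !divr_ge0 ?subr_ge0 // ltW.
rewrite hits_card; set P := [pred k | _].
pose z (k : 'I_K) := Num.floor (beta * k%:R + gamma - u).
pose g (k : 'I_K) := a * k%:Z - r%:Z * z k.
have H : r%:R * u <= r%:R * v by rewrite ler_pM2l.
have dK : 0 <= d * K%:R by rewrite mulr_ge0 ?(ltW d0).
have Pbnd k : P k -> r%:R * (u - gamma) <= (g k)%:~R + eta * k%:R <= r%:R * (v - gamma).
  rewrite /= itv_modZE -/(z k) => kv.
  have /andP[f1 _] := floor_itv (beta * k%:R + gamma - u); rewrite -/(z k) in f1.
  have -> : (g k)%:~R + eta * k%:R = r%:R * (beta * k%:R - (z k)%:~R).
    by rewrite /g /eta rmorphB !rmorphM /= -!pmulrn; ring.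
  by rewrite !ler_pM2l//; apply/andP; split; lra.
pose x := r%:R * (u - gamma) - d * K%:R; pose y := r%:R * (v - gamma) + d * K%:R.
have -> : r%:R * (v - u) + 2 * (d * K%:R) + 1 = y - x + 1 by rewrite /x /y; ring.
apply: (@card_fibers_le R _ P g); rewrite ?addr_ge0//.
- by rewrite /x /y; lra.
- move=> k /Pbnd /andP[b1 b2].
  have : `|eta * k%:R| <= d * K%:R.
    by rewrite normrM ler_wpM2l// normr_nat ler_nat ltnW.
  by rewrite ler_norml => /andP[b3 b4]; rewrite /x /y; apply/andP; split; lra.
move=> c; set F := [pred i | _]; have [i0 Fi0|F0] := pickP F; last first.
  by rewrite (eq_card0 F0) addr_ge0.
(* Measured from the least element [k0] of the fibre, every element is [k0 + r t] with [t] natural;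
   [t <= M] leaves at most [M + 1] of them. *)
case: (arg_minnP (fun i : 'I_K => i : nat) Fi0) => k0 Fk0 kmin.
have Fdvd k : F k -> exists2 t : nat, (k = k0 + r * t :> nat)%N & t%:R <= M.
  move=> Fk; have lk := kmin _ Fk; case/andP: Fk => Pk /eqP gk.
  case/andP: (Fk0) => Pk0 /eqP gk0.
  have : (r%:Z %| a * (k%:Z - k0%:Z))%Z.
    apply/dvdzP; exists (z k - z k0); move: gk; rewrite -gk0 /g => e.
    have -> : a * (k%:Z - k0%:Z) = a * k0%:Z - r%:Z * z k0 + r%:Z * z k - a * k0%:Z.
      by rewrite -e subrK mulrBr.
    ring.
  rewrite Gauss_dvdzr; last by rewrite coprimez_sym.
  rewrite subzn// => /dvdnP[t tE]; have kE : (k = k0 + r * t :> nat)%N.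
    by rewrite mulnC -tE subnKC.
  exists t => //.
  have tE' : k%:R = k0%:R + r%:R * t%:R :> R by rewrite kE natrD natrM.
  rewrite le_min; apply/andP; split.
    rewrite ler_pdivlMr// mulrC -natrM ler_nat.
    by apply: leq_trans (ltnW (ltn_ord k)); rewrite kE leq_addl.
  (* For fixed [c], passing from [k0] to [k] moves the point by [eta r t] inside an interval of
     length [r (v - u)]. *)
  rewrite ler_pdivlMr// -(ler_pM2l r0').
  have := Pbnd _ Pk; have := Pbnd _ Pk0; rewrite gk gk0 tE'.
  move=> /andP[b1 b2] /andP[b3 b4].
  have -> : r%:R * (t%:R * d) = `|eta * (r%:R * t%:R)|.
    by rewrite normrM (ger0_norm (x := _ * _)) ?mulr_ge0 // -/d; ring.
  by rewrite ler_norml; apply/andP; split; lra.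
have := @card_int_inj_le R _ F (fun k => ((k - k0) %/ r)%N%:Z) 0 M M0.
rewrite subr0; apply.
  move=> k /Fdvd[t -> tM]; rewrite addKn mulKn// -pmulrn.
  by rewrite ler0n.
move=> i j /Fdvd[t it _] /Fdvd[t' jt _].
rewrite it jt !addKn !mulKn// => -[tt]; apply/ord_inj.
by rewrite it jt tt.
Qed.

(** Pigeonhole: the fractional parts of [k beta], [0 <= k <= n], fall into [n] boxes of width
    [1 / n], and two in one box differ by a multiple [s beta] close to an integer. *)
Lemma dirichlet_approx beta (n : nat) : (0 < n)%N ->
  exists a : int, exists r : nat,
    [/\ (0 < r <= n)%N, coprimez a r & `|r%:R * beta - a%:~R| <= n%:R^-1].
Proof.
move=> n0; have n0' : 0 < n%:R :> R by rewrite ltr0n.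
have fr (k : nat) : 0 <= k%:R * beta - (Num.floor (k%:R * beta))%:~R < 1.
  by have := floor_itv (k%:R * beta); rewrite rmorphD /=; lra.
have bnd (k : 'I_n.+1) :
    (Num.truncn (n%:R * (k%:R * beta - (Num.floor (k%:R * beta))%:~R)) < n)%N.
  have /andP[f0 f1] := fr k; rewrite -(ltr_nat R).
  have /andP[t0 _] := truncn_itv (mulr_ge0 (ler0n R n) f0).
  by apply: le_lt_trans t0 _; rewrite -[ltRHS]mulr1 ltr_pM2l.
have : ~~ injectiveb (fun k => Ordinal (bnd k)).
  apply/injectiveP => /leq_card; rewrite !card_ord; lia.
case/injectivePn => i0 [j0 ij0 eij0].
have [i [j [ij eij]]] : exists i j : 'I_n.+1,
    (i < j)%N /\ Ordinal (bnd i) = Ordinal (bnd j).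
  case: (ltngtP i0 j0) => h; [by exists i0, j0|by exists j0, i0|].
  by move: ij0; rewrite -(inj_eq val_inj) /= h eqxx.
move: eij => [] eij.
have [/andP[fi0 fi1] /andP[fj0 fj1]] := (fr i, fr j).
have /andP[ti0 ti1] := truncn_itv (mulr_ge0 (ler0n R n) fi0).
have /andP[tj0 tj1] := truncn_itv (mulr_ge0 (ler0n R n) fj0).
rewrite eij in ti0 ti1; rewrite -natr1 in ti1; rewrite -natr1 in tj1.
pose s := (j - i)%N; pose b := Num.floor (j%:R * beta) - Num.floor (i%:R * beta).
have s0 : (0 < s)%N by rewrite subn_gt0.
have sb : `|s%:R * beta - b%:~R| <= n%:R^-1.
  rewrite -(ler_pM2l n0') divff ?gt_eqF//.
  rewrite -[X in X * _](ger0_norm (ler0n R n)) -normrM ler_norml.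
  by rewrite /s /b natrB 1?ltnW// rmorphB /=; apply/andP; split; lra.
(* Removing the common factor [g] makes the fraction reduced and divides the error by [g]. *)
pose g := gcdn `|b|%N s; have g0 : (0 < g)%N by rewrite gcdn_gt0 s0 orbT.
have /dvdnP[r rE] : (g %| s)%N by rewrite dvdn_gcdr.
have /dvdzP[a aE] : (g%:Z %| b)%Z by rewrite dvdzE /= dvdn_gcdl.
have r0 : (0 < r)%N by move: s0; rewrite rE muln_gt0 => /andP[].
exists a, r; split.
- rewrite r0 /=; apply: (@leq_trans s); first by rewrite rE leq_pmulr.
  by apply: leq_trans (leq_subr _ _) _; exact: leq_ord.
- rewrite coprimezE /coprime -(eqn_pmul2r g0) mul1n muln_gcdl -rE.
  by have -> : (`|a| * g = `|b|)%N by rewrite aE abszM.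
- apply: le_trans sb; rewrite rE aE natrM rmorphM /= -pmulrn.
  rewrite [_ * g%:R * _]mulrAC -mulrBl normrM normr_nat ler_peMr// ler1n.
  exact: g0.
Qed.
End Drift.

(** * Divisors and harmonic sums *)

(** Each divisor is its [p]-part [p ^ i], [i <= a], times its prime-to-[p] part, a divisor of
    [m]. *)
Lemma size_divisors_coprime_prime (p a m : nat) : prime p -> (0 < m)%N ->
  coprime p m -> (size (divisors (p ^ a * m)) <= a.+1 * size (divisors m))%N.
Proof.
move=> pp m0 pm; rewrite -[a.+1](size_iota 0).
rewrite -(size_allpairs (fun i d => p ^ i * d)%N).
apply: uniq_leq_size (divisors_uniq _) _ => d.
have pam0 : (0 < p ^ a * m)%N by rewrite muln_gt0 expn_gt0 prime_gt0.
rewrite -dvdn_divisors// => dvd; have d0 := dvdn_gt0 pam0 dvd.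
apply/allpairsP; exists (logn p d, d`_p^')%N; split.
- rewrite mem_iota /= add0n ltnS -(@dvdn_Pexp2l p) ?prime_gt1//.
  rewrite -(@Gauss_dvdl _ _ m); last by rewrite coprimeXl.
  by apply: dvdn_trans dvd; rewrite -p_part dvdn_part.
- rewrite /= -dvdn_divisors// -(@Gauss_dvdr _ (p ^ a)%N).
    by apply: dvdn_trans dvd; rewrite dvdn_part.
  rewrite coprimeXr// coprime_sym; apply: (@pnat_coprime p).
    by rewrite pnat_id.
  by rewrite part_pnat.
- by rewrite /= -p_part partnC.
Qed.

(** Compare [a + 1] with [p ^ (e a)] one prime at a time. Once [p ^ e >= 2] no constant is lost, so
    only primes below [P] cost a factor [C0]. *)
Lemma divisor_bound (R : realType) (e : R) : 0 < e ->
  exists2 C : R, 0 < C &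
    forall n : nat, (0 < n)%N -> (size (divisors n))%:R <= C * n%:R `^ e.
Proof.
move=> e0; pose x : R := 2 `^ e.
have x1 : 1 < x.
  have : 1 `^ e < x by apply: gt0_ltr_powR; rewrite ?nnegrE ?ltr1n.
  by rewrite powR1.
(* Chosen so that [C0 (x - 1) >= 1]; Bernoulli's inequality then gives [a + 1 <= C0 x ^ a]. *)
pose C0 : R := Num.max 1 (x - 1)^-1.
have C01 : 1 <= C0 by rewrite le_max lexx.
have C0x : 1 <= C0 * (x - 1).
  rewrite -ler_pdivrMr ?subr_gt0// div1r le_max; apply/orP; right; exact: lexx.
pose P := (Num.truncn (2 `^ e^-1 : R)).+1.
have bern (y : R) a : 1 <= y -> 1 + a%:R * (y - 1) <= y ^+ a.
  move=> y1; elim: a => [|a IH]; first by rewrite expr0; lra.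
  rewrite exprS -natr1; have a0 : 0 <= a%:R :> R by [].
  have : y * (1 + a%:R * (y - 1)) <= y * y ^+ a by rewrite ler_pM2l//; lra.
  have : 0 <= a%:R * (y - 1) * (y - 1) by rewrite !mulr_ge0// subr_ge0.
  by nra.
have small (p a : nat) : (2 <= p)%N -> a.+1%:R <= C0 * (p%:R `^ e) ^+ a.
  move=> p2; have xp : x <= p%:R `^ e.
    by apply: ge0_ler_powR; rewrite ?nnegrE ?ler0n ?ler_nat ?(ltW e0).
  apply: (@le_trans _ _ (C0 * x ^+ a)); last first.
    by rewrite ler_wpM2l ?lerXn2r ?nnegrE ?powR_ge0//; lra.
  apply: (@le_trans _ _ (C0 * (1 + a%:R * (x - 1)))); last first.
    by apply: ler_wpM2l; [lra|apply: bern; lra].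
  have : a%:R * 1 <= a%:R * (C0 * (x - 1)) by rewrite ler_wpM2l.
  by rewrite -natr1; lra.
have large (p a : nat) : (P <= p)%N -> a.+1%:R <= (p%:R `^ e) ^+ a.
  move=> Pp; have p2 : 2 <= p%:R `^ e.
    have -> : 2 = (2 `^ e^-1) `^ e :> R by rewrite -powRrM mulVf ?gt_eqF// powRr1.
    apply: ge0_ler_powR; rewrite ?nnegrE ?powR_ge0 ?ler0n ?(ltW e0)//.
    have /andP[_ /ltW h] := truncn_itv (powR_ge0 (2 : R) e^-1).
    by apply: le_trans h _; rewrite ler_nat.
  apply: (@le_trans _ _ (1 + a%:R * (p%:R `^ e - 1))); last by apply: bern; lra.
  have : a%:R * 1 <= a%:R * (p%:R `^ e - 1) by rewrite ler_wpM2l//; lra.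
  by rewrite -natr1; lra.
have C00 : 0 <= C0 by lra.
clearbody C0 P.
(* Induction on a strict bound [k] for the prime factors of [n]; [minn k P] bounds the number of
   factors [C0] spent. *)
have key k n : (0 < n)%N -> (forall p, prime p -> (p %| n)%N -> (p < k)%N) ->
    (size (divisors n))%:R <= C0 ^+ minn k P * n%:R `^ e.
  elim: k n => [|k IH] n n0 pn.
    have -> : n = 1%N.
      apply/eqP; rewrite eqn_leq n0 andbT leqNgt; apply/negP => n1.
      by have := pn _ (pdiv_prime n1) (pdiv_dvd n).
    by rewrite min0n expr0 powR1 mul1r.
  have mono : C0 ^+ minn k P <= C0 ^+ minn k.+1 P.
    by apply: ler_weXn2l => //; rewrite leq_min geq_minr (leq_trans (geq_minl _ _)).
  have [pk|npk] := boolP (prime k); last first.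
    apply: le_trans (IH n n0 _) _; last by rewrite ler_wpM2r ?powR_ge0.
    move=> p pp pd; have := pn p pp pd; rewrite ltnS leq_eqVlt => /orP[/eqP pe|//].
    by rewrite -pe pp in npk.
  pose m := (n`_k^')%N; pose a := logn k n.
  have nE : n = (k ^ a * m)%N by rewrite /a -p_part partnC.
  have m0 : (0 < m)%N by rewrite part_gt0.
  have km : coprime k m.
    by apply: (@pnat_coprime k); rewrite ?pnat_id// part_pnat.
  have Dm : (size (divisors m))%:R <= C0 ^+ minn k P * m%:R `^ e.
    apply: IH => // p pp pd; have := pn p pp (dvdn_trans pd (dvdn_part _ _)).
    rewrite ltnS leq_eqVlt => /orP[/eqP pe|//].
    by move: km; rewrite -pe prime_coprime// pd.
  have nE' : n%:R `^ e = (k%:R `^ e) ^+ a * m%:R `^ e.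
    have -> : n%:R = k%:R ^+ a * m%:R :> R by rewrite -natrX -natrM -nE.
    rewrite powRM// ?exprn_ge0//; congr (_ * _).
    rewrite -(powR_mulrn a (ler0n R k)) -(powR_mulrn a (powR_ge0 k%:R e)).
    exact: powRAC.
  have le1 : (size (divisors n))%:R <= a.+1%:R * (C0 ^+ minn k P * m%:R `^ e).
    apply: (@le_trans _ _ (a.+1%:R * (size (divisors m))%:R)); last first.
      by rewrite ler_wpM2l.
    by rewrite -natrM ler_nat {1}nE size_divisors_coprime_prime.
  apply: le_trans le1 _; rewrite nE'.
  set Z := (k%:R `^ e) ^+ a; set W := m%:R `^ e.
  have W0 : 0 <= W by rewrite powR_ge0.
  have Q0 : 0 <= C0 ^+ minn k P by exact: exprn_ge0.
  have [kP|Pk] := ltnP k P.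
    rewrite (minn_idPl kP) -(minn_idPl (ltnW kP)) exprS.
    move: (C0 ^+ minn k P) Q0 (small k a (prime_gt1 pk)) => Q Q0 h.
    rewrite [leRHS](_ : _ = (C0 * Z) * (Q * W)); last by rewrite mulrACA mulrA.
    by apply: ler_wpM2r h; rewrite mulr_ge0.
  rewrite (minn_idPr (leqW Pk)) -(minn_idPr Pk).
  move: (C0 ^+ minn k P) Q0 => Q Q0.
  rewrite [leRHS](_ : _ = Z * (Q * W)); last by rewrite mulrCA.
  by apply: ler_wpM2r (large _ _ Pk); rewrite mulr_ge0.
exists (C0 ^+ P); first by apply: exprn_gt0; lra.
move=> n n0; apply: le_trans (key n.+1 n n0 _) _.
  by move=> p _ pd; rewrite ltnS dvdn_leq.
by rewrite ler_wpM2r ?powR_ge0// ler_weXn2l// geq_minr.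
Qed.

(** The sum is at most [1 + ln n], and [e ln n = ln (n ^ e) <= n ^ e]. *)
Lemma harmonic_sum_le (R : realType) (e : R) (n : nat) : 0 < e -> (0 < n)%N ->
  \sum_(1 <= m < n.+1) m%:R^-1 <= (1 + e^-1) * n%:R `^ e.
Proof.
move=> e0 n0; have n1 : 1 <= n%:R :> R by rewrite ler1n.
have Hln : \sum_(1 <= m < n.+1) m%:R^-1 <= 1 + ln n%:R :> R.
  elim: n n0 {n1} => // -[|n] IH _; first by rewrite big_nat1 ln1 invr1 addr0.
  rewrite big_nat_recr//=; have {}IH := IH isT.
  have p1 : 0 < n.+1%:R :> R by rewrite ltr0n.
  have p2 : 0 < n.+2%:R :> R by rewrite ltr0n.
  (* [1 / (n + 2) <= - ln (1 - 1 / (n + 2)) = ln (n + 2) - ln (n + 1)]. *)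
  have := @le_ln1Dx R (- n.+2%:R^-1).
  have -> : 1 + - n.+2%:R^-1 = n.+1%:R / n.+2%:R :> R.
    by rewrite -[n.+1%:R](addrK 1) natr1 mulrBl divff ?gt_eqF// mul1r.
  rewrite ln_div ?posrE// => h; rewrite ltrN2 invf_lt1// ltr1n in h.
  move: (h isT) IH; move: (\sum_(_ <= _ < _) _) (ln _) (ln _) (_^-1) => S a b c; lra.
apply: le_trans Hln _.
have ne1 : 1 <= n%:R `^ e by have := ler_powR n1 (ltW e0); rewrite powRr0.
have : e * ln n%:R <= n%:R `^ e.
  rewrite -ln_powR; have := @le_ln1Dx R (n%:R `^ e - 1).
  by rewrite addrCA subrr addr0 => h; have := h ltac:(lra); lra.
rewrite -ler_pdivlMl// mulrC => h; rewrite mulrDl mul1r [e^-1 * _]mulrC; lra.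
Qed.

(** * Summing the errors of small denominators *)

(* For every factorization [n = h r] with [h <= N], this dominates
   [min (N / r) (L / d)], [d] being the distance from [A n] to the integers: the
   first term covers [d <= 1 / q], and otherwise
   [1 / d <= 1 + #{m <= q | d <= 1 / m}]. *)
Definition small_denominator_weight (R : realType) (A L : R) (N q n : nat) : R :=
  Num.min N%:R (N%:R ^+ 2 / n%:R) * (A * n%:R \in itv_modZ (- q%:R^-1) q%:R^-1)%:R +
  L * (1 + \sum_(1 <= m < q.+1) (A * n%:R \in itv_modZ (- m%:R^-1) m%:R^-1)%:R).

Section Weight.
Context {R : realType}.
Local Notation weight := (@small_denominator_weight R).

Lemma weight_ge0 A L N q n : 0 <= L -> 0 <= weight A L N q n.
Proof.
move=> L0; apply: addr_ge0.
  by apply: mulr_ge0 => //; rewrite le_min ler0n divr_ge0 ?sqr_ge0.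
by apply: mulr_ge0 => //; apply: addr_ge0 => //; apply: sumr_ge0.
Qed.

Lemma min_le_weight (A L : R) (a : int) (N q h r : nat) :
  (0 < r)%N -> (0 < h <= N)%N -> (0 < q)%N -> 0 <= L ->
  0 < `|A * (h * r)%:R - a%:~R| ->
  Num.min (N%:R / r%:R) (L / `|A * (h * r)%:R - a%:~R|) <= weight A L N q (h * r).
Proof.
move=> r0 /andP[h0 hN] q0 L0; set x := A * _; set d := `|_| => d0.
have near t : d <= t -> x \in itv_modZ (- t) t.
  by rewrite ler_norml => dt; apply/itv_modZP; exists a.
have r0' : 0 < r%:R :> R by rewrite ltr0n.
have h0' : 0 < h%:R :> R by rewrite ltr0n.
have sum0 : 0 <= \sum_(1 <= m < q.+1) (x \in itv_modZ (- m%:R^-1) m%:R^-1)%:R :> R.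
  exact: sumr_ge0.
rewrite /small_denominator_weight -/x.
have [dq|qd] := leP d q%:R^-1.
  rewrite near// mulr1; apply: ler_wpDr; first by rewrite mulr_ge0// addr_ge0.
  (* [N / r <= N] because [r >= 1], and [N / r = N h / (h r) <= N ^ 2 / (h r)] because [h <= N]. *)
  rewrite le_min; apply/andP; split.
    by rewrite ge_min ler_pdivrMr// ler_peMr// ler1n r0.
  rewrite ge_min; apply/orP; left; rewrite natrM invfM mulrA ler_pM2r ?invr_gt0//.
  by rewrite ler_pdivlMr// expr2 ler_wpM2l// ler_nat.
apply: ler_wpDl.
  by apply: mulr_ge0 => //; rewrite le_min ler0n divr_ge0 ?sqr_ge0.
rewrite ge_min; apply/orP; right; apply: ler_wpM2l => //.
(* The integer part [t] of [1 / d] is at most [q], and [d <= 1 / m] for [m = 1, ..., t]; so the sum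
   is at least [t], while [1 / d < t + 1]. *)
have /andP[t0 t1] := truncn_itv (ltW (y := d^-1) (x := 0) ltac:(by rewrite invr_gt0)).
move: t0 t1; set t := Num.truncn _ => t0 t1.
have tq : (t.+1 <= q.+1)%N.
  rewrite ltnS -(ler_nat R); apply: le_trans t0 _; rewrite -[leRHS]invrK.
  by rewrite lef_pV2 ?posrE ?invr_gt0 ?ltr0n// ltW.
rewrite (big_cat_nat (ltn0Sn t) tq) /=.
have -> : \sum_(1 <= m < t.+1) (x \in itv_modZ (- m%:R^-1) m%:R^-1)%:R = t%:R :> R.
  rewrite -[RHS](_ : \sum_(1 <= m < t.+1) 1 = _); last first.
    by rewrite sumr_const_nat subn1.
  apply: eq_big_nat => m /andP[m0 mt]; rewrite near//.
  rewrite -[d]invrK lef_pV2 ?posrE ?invr_gt0 ?ltr0n//.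
  by apply: le_trans t0; rewrite ler_nat.
rewrite addrA nat1r; apply: ler_wpDr (ltW t1).
by apply: sumr_ge0.
Qed.

(** Take Dirichlet's [r <= Q] for the slope [A h]. If [r L >= E], the discrepancy bound is of order
    [N L / E + 1]. Otherwise [n = h r] is at most [N E / L], and drift bounds both the count and the
    main term by a multiple of [E (1 + weight)]. *)
Lemma hits_error_le_weight (A L E u v gamma : R) (N Q q h K : nat) :
  1 <= E -> 0 < L <= 1 -> v - u = L -> (0 < Q)%N -> (0 < q)%N ->
  Q%:R * E <= N%:R <= 2 * E * Q%:R ->
  (forall (n : nat) (a : int), (0 < n)%N -> A * n%:R != a%:~R) ->
  (0 < h <= N)%N -> (K <= N)%N ->
  exists n : nat, [/\ (h %| n)%N, (0 < n)%N, n%:R <= N%:R * E / L &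
    `|hits (A * h%:R) gamma u v K - K%:R * L| <=
    4 * (N%:R * L / E) + 3 + 8 * E * (1 + weight A L N q n)].
Proof.
move=> E1 /andP[L0 L1] vuL Q0 q0 /andP[QE NE] irr hN KN.
have [h0 hN'] := andP hN.
have [a [r [/andP[r0 rQ] car dQ]]] := dirichlet_approx (A * h%:R) Q0.
have E0 : 0 < E by lra.
have r0' : 0 < r%:R :> R by rewrite ltr0n.
have Q0' : 0 < Q%:R :> R by rewrite ltr0n.
have rQ' : r%:R <= Q%:R :> R by rewrite ler_nat.
have KN' : K%:R <= N%:R :> R by rewrite ler_nat.
have N0 : 0 <= N%:R :> R by [].
have dr : `|r%:R * (A * h%:R) - a%:~R| <= r%:R^-1.
  by apply: le_trans dQ _; rewrite lef_pV2 ?posrE.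
have uv : u <= v by lra.
have vu : v <= u + 1 by lra.
have W0 n : 0 <= 8 * E * (1 + weight A L N q n).
  apply: mulr_ge0; first lra.
  by apply: addr_ge0 => //; apply: weight_ge0; lra.
have [ErL|rLE] := leP E (r%:R * L).
  (* The weight is nonnegative, so any admissible [n] serves in this case. *)
  exists h; split => //.
    rewrite -mulrA; apply: (@le_trans _ _ N%:R); first by rewrite ler_nat.
    by rewrite ler_peMr// ler_pdivlMr//; lra.
  apply: ler_wpDr => //; rewrite -vuL.
  apply: le_trans (hits_discrepancy gamma K r0 car dr uv vu) _; rewrite vuL.
  apply: lerD => //.
  have h1 : r%:R * L <= N%:R * L / E.
    rewrite mulrAC ler_wpM2r ?(ltW L0)// ler_pdivlMr//; apply: le_trans QE.
    by rewrite ler_pM2r.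
  have h2 : K%:R / r%:R <= N%:R * L / E.
    rewrite -mulrA; apply: ler_pM => //; rewrite ?invr_ge0 ?ler0n//.
    by rewrite ler_pdivlMr// ler_pdivrMl.
  lra.
exists (h * r)%N; split; rewrite ?dvdn_mulr ?muln_gt0 ?h0//.
  rewrite natrM -mulrA; apply: ler_pM => //; first by rewrite ler_nat.
  by rewrite ler_pdivlMr// ltW.
have xE : r%:R * (A * h%:R) = A * (h * r)%:R by rewrite natrM; ring.
have d0 : 0 < `|r%:R * (A * h%:R) - a%:~R|.
  by rewrite normr_gt0 subr_eq0 xE irr// muln_gt0 h0.
have hw := @min_le_weight A L a N q h r r0 hN q0 (ltW L0).
rewrite -xE in hw; have {}hw := hw d0.
have hd := hits_drift_le gamma K r0 car d0 uv; rewrite vuL in hd.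
move: d0 dQ dr hw hd; set d := `|_| => d0 dQ dr; set w := weight _ _ _ _ _ => hw hd.
have dN : d * N%:R <= 2 * E.
  apply: le_trans (ler_wpM2r N0 dQ) _; rewrite ler_pdivrMl// [leRHS]mulrC; lra.
have dK : d * K%:R <= 2 * E by apply: le_trans dN; rewrite ler_wpM2l// ltW.
set m := Num.min (N%:R / r%:R) (L / d) in hw.
have mm : Num.min (K%:R / r%:R) (L / d) <= m.
  rewrite le_min !ge_min lexx orbT andbT; apply/orP; left.
  by rewrite ler_wpM2r ?invr_ge0.
have m0 : 0 <= Num.min (K%:R / r%:R) (L / d).
  by rewrite le_min !divr_ge0//; apply: ltW.
(* The main term is absorbed too: [r L < E] gives [N L <= E N / r], and [d N <= 2 E] gives
   [N L <= 2 E L / d]. *)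
have NLm : N%:R * L <= 2 * E * m.
  rewrite /m minr_pMr ?mulr_ge0 ?(ltW E0)// le_min; apply/andP; split.
    rewrite mulrA ler_pdivlMr//.
    have : N%:R * (r%:R * L) <= N%:R * E by rewrite ler_wpM2l// ltW.
    have : 0 <= N%:R * E by rewrite mulr_ge0// ltW.
    lra.
  rewrite mulrA ler_pdivlMr//.
  have : L * (d * N%:R) <= L * (2 * E) by rewrite ler_wpM2l// ltW.
  lra.
(* The first factor of the drift bound is at most [E + 4 E + 1 <= 6 E]. *)
have hh : hits (A * h%:R) gamma u v K <= 6 * E * (m + 1).
  apply: le_trans hd _.
  by apply: ler_pM; rewrite ?addr_ge0 ?mulr_ge0 ?(ltW d0) ?(ltW L0)//; lra.
have hg := hits_ge0 (A * h%:R) gamma u v K.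
have KL : K%:R * L <= N%:R * L by rewrite ler_wpM2r// ltW.
have KL0 : 0 <= K%:R * L by rewrite mulr_ge0// ltW.
have Em : E * m <= E * w by rewrite ler_wpM2l// ltW.
have NL0 : 0 <= N%:R * L / E by rewrite !mulr_ge0 ?invr_ge0// ltW.
rewrite ler_norml; apply/andP; split; lra.
Qed.

(** Cut into [B] blocks of length [q]. At most [q (2 / q) + 3 = 5] points of a block come within
    [1 / q] of an integer, and the minimum there is at most [N] in block 0 and [N ^ 2 / (i q)] in
    block [i]. In the other term the sums are exchanged: each [m] counts at most [B (2 q / m + 3)]
    points. *)
Lemma sum_weight_le (A L : R) (p : int) (N q B : nat) :
  0 <= L -> (0 < q)%N -> (0 < B)%N -> coprimez p q ->
  `|q%:R * A - p%:~R| <= q%:R^-1 ->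
  \sum_(1 <= n < B * q) weight A L N q n <=
  5 * (N%:R + N%:R ^+ 2 / q%:R * \sum_(1 <= m < B.+1) m%:R^-1) +
  L * (B * q)%:R * (4 + 2 * \sum_(1 <= m < q.+1) m%:R^-1).
Proof.
move=> L0 q0 B0 cpq dq; have q0' : 0 < q%:R :> R by rewrite ltr0n.
have near_hits t K : \sum_(0 <= n < K) (A * n%:R \in itv_modZ (- t) t)%:R =
    hits A 0 (- t) t K by apply: eq_bigr => n _; rewrite addr0.
(* Adding the nonnegative term [n = 0] completes the first block. *)
have ext (f : nat -> R) : (forall n, 0 <= f n) ->
    \sum_(1 <= n < B * q) f n <= \sum_(0 <= n < B * q) f n.
  move=> f0; rewrite [leRHS](@big_ltn _ _ _ 0) ?muln_gt0 ?B0//.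
  exact: ler_wpDl.
rewrite big_split /=; apply: lerD.
  apply: le_trans (ext _ _) _.
    by move=> n; rewrite mulr_ge0// le_min ler0n divr_ge0 ?sqr_ge0.
  rewrite big_nat_mul big_ltn//=.
  have blk i (c : R) : 0 <= c ->
      (forall n, (i * q <= n)%N -> Num.min N%:R (N%:R ^+ 2 / n%:R) <= c) ->
      \sum_(i * q <= n < i.+1 * q)
        Num.min N%:R (N%:R ^+ 2 / n%:R) * (A * n%:R \in itv_modZ (- q%:R^-1) q%:R^-1)%:R
      <= 5 * c.
    move=> c0 cn.
    apply: (@le_trans _ _ (\sum_(i * q <= n < i.+1 * q)
      c * (A * n%:R \in itv_modZ (- q%:R^-1) q%:R^-1)%:R)).
      by apply: ler_sum_nat => n /andP[nq _]; apply: ler_wpM2r => //; apply: cn.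
    rewrite -big_distrr /= mulrC; apply: ler_wpM2r => //.
    rewrite -{1}[(i * q)%N]add0n big_addn mulSn addnK.
    apply: (@le_trans _ _ (hits A (A * (i * q)%:R) (- q%:R^-1) q%:R^-1 q)).
      by apply: ler_sum => k _; rewrite natrD mulrDr.
    have qi0 : 0 <= q%:R^-1 :> R by rewrite invr_ge0.
    apply: le_trans (hits_block_le _ q0 cpq dq _) _; first lra.
    by rewrite opprK mulrDr divff ?gt_eqF//; lra.
  rewrite mulrDr; apply: lerD.
    by apply: blk => // n _; rewrite ge_min lexx.
  rewrite big_distrr big_distrr /= big_nat_recr//=; apply: ler_wpDr.
    by rewrite !mulr_ge0 ?invr_ge0.
  apply: ler_sum_nat => i /andP[i0 _]; apply: blk.
    by rewrite !mulr_ge0 ?invr_ge0.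
  move=> n iqn; rewrite ge_min; apply/orP; right; rewrite -mulrA ler_wpM2l//.
  rewrite -invfM -natrM lef_pV2 ?posrE ?ltr0n ?muln_gt0 ?q0 ?i0// ?ler_nat 1?mulnC//.
  by apply: leq_trans iqn; rewrite muln_gt0 i0.
rewrite -big_distrr /= -mulrA; apply: ler_wpM2l => //.
rewrite big_split /=.
have -> : 4 + 2 * \sum_(1 <= m < q.+1) m%:R^-1 =
    1 + (3 + 2 * \sum_(1 <= m < q.+1) m%:R^-1) :> R.
  by ring.
rewrite mulrDr mulr1; apply: lerD.
  by rewrite sumr_const_nat ler_nat leq_subr.
rewrite exchange_big /=.
apply: (@le_trans _ _ (\sum_(1 <= m < q.+1) (B%:R * 3 + B%:R * q%:R * (2 * m%:R^-1)))).
  apply: ler_sum_nat => m /andP[m0 _]; apply: le_trans (ext _ _) _ => //.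
  have m0' : 0 <= m%:R^-1 :> R by rewrite invr_ge0.
  rewrite near_hits; apply: le_trans (hits_upper _ B q0 cpq dq _) _; first lra.
  by rewrite opprK; lra.
rewrite big_split /= -!big_distrr /= sumr_const_nat subn1 natrM -mulr_natr /=; lra.
Qed.

(** Since [h] divides [f h], a given [n] equals [f h] only for [h] among its divisors, hence at most
    [D] times. *)
Lemma sum_divisors_le (F : nat -> R) (f : nat -> nat) (D : R) (N M : nat) :
  (forall n, 0 <= F n) ->
  (forall h, (0 < h < N)%N -> (h %| f h)%N /\ (0 < f h < M)%N) ->
  (forall n, (0 < n < M)%N -> (size (divisors n))%:R <= D) ->
  \sum_(1 <= h < N) F (f h) <= D * \sum_(1 <= n < M) F n.
Proof.
move=> F0 fh Dn.
have -> : \sum_(1 <= h < N) F (f h) =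
    \sum_(1 <= h < N) \sum_(1 <= n < M) (f h == n)%:R * F n.
  apply: eq_big_nat => h hN; have [_ fM] := fh h hN.
  rewrite (bigD1_seq (f h)) ?iota_uniq ?mem_index_iota//= eqxx mul1r.
  by rewrite big1 ?addr0// => n; rewrite eq_sym => /negbTE ->; rewrite mul0r.
rewrite exchange_big /= big_distrr /=; apply: ler_sum_nat => n nM.
rewrite -big_distrl /=; apply: ler_wpM2r => //; apply: le_trans (Dn n nM).
have n0 : (0 < n)%N by case/andP: nM.
rewrite -natr_sum ler_nat.
apply: (@leq_trans (\sum_(1 <= h < N) (h \in divisors n))%N).
  rewrite big_nat_cond [leqRHS]big_nat_cond; apply: leq_sum => h /andP[hN _].
  case: eqP => // <-.
  by have [hf /andP[f0 _]] := fh h hN; rewrite -dvdn_divisors// hf.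
rewrite -[leqLHS](_ : count (mem (divisors n)) (index_iota 1 N) = _); last first.
  by rewrite -sum1_count big_mkcond /=; apply: eq_bigr => i _; case: ifP.
rewrite -size_filter; apply: uniq_leq_size; first by rewrite filter_uniq ?iota_uniq.
by move=> h; rewrite mem_filter => /andP[].
Qed.
End Weight.

(** * Pairs as progressions *)

Section PairCount.
Context {R : realType}.
Implicit Types (alpha u v L E D H : R).

(** Pairs are sorted by the distance [h] of their indices. Induction on [N]: the new row and column
    contribute one pair in each order for every [h]. *)
Lemma sum_offdiag (f : nat -> nat -> R) (N : nat) : (forall j, f j j = 0) ->
  \sum_(0 <= j < N) \sum_(0 <= k < N) f j k =
  \sum_(1 <= h < N) \sum_(0 <= k < N - h) (f (k + h)%N k + f k (k + h)%N).
Proof.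
move=> f0; elim: N => [|N IH]; first by rewrite !big_geq.
rewrite big_nat_recr//= [X in _ + X]big_nat_recr//= f0 addr0.
have -> : \sum_(0 <= j < N) \sum_(0 <= k < N.+1) f j k =
    \sum_(0 <= j < N) \sum_(0 <= k < N) f j k + \sum_(0 <= j < N) f j N.
  by rewrite -big_split /=; apply: eq_bigr => j _; rewrite big_nat_recr.
rewrite IH -addrA -big_split /=.
have -> : \sum_(1 <= h < N.+1) \sum_(0 <= k < N.+1 - h)
     (f (k + h)%N k + f k (k + h)%N) =
   \sum_(1 <= h < N.+1) (\sum_(0 <= k < N - h) (f (k + h)%N k + f k (k + h)%N) +
     (f N (N - h)%N + f (N - h)%N N)).
  apply: eq_big_nat => h /andP[h0 hN]; rewrite subSn// big_nat_recr//=.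
  by rewrite subnK.
rewrite [RHS]big_split /=; congr (_ + _).
  case: N {IH} => [|N]; first by rewrite !big_geq.
  by rewrite [RHS]big_nat_recr//= subnn [X in _ = _ + X]big_geq ?addr0.
rewrite big_add1 /= [LHS]big_nat_rev /=; apply: eq_bigr => i _.
by rewrite add0n addrC.
Qed.

Lemma itv_modZN u v (x : R) : (x \in itv_modZ u v) = (- x \in itv_modZ (- v) (- u)).
Proof.
apply/itv_modZP/itv_modZP => -[m /andP[h1 h2]]; exists (- m);
  by rewrite rmorphN /=; apply/andP; split; lra.
Qed.

(** [(k + h + 1) ^ 2 - (k + 1) ^ 2 = 2 h k + h (h + 2)], the shift by 1 coming from indexing the
    sequence from 1. The reversed pair has the opposite value, hence the arc [[- v, - u]]. *)
Lemma pair_count_hits alpha u v (N : nat) :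
  #|[set jk : 'I_N * 'I_N | (jk.1 != jk.2) &&
      (alpha * jk.1.+1%:R ^+ 2 - alpha * jk.2.+1%:R ^+ 2 \in itv_modZ u v)]%SET|%:R =
  \sum_(1 <= h < N)
    (hits (2 * alpha * h%:R) (alpha * h%:R * (h%:R + 2)) u v (N - h) +
     hits (2 * alpha * h%:R) (alpha * h%:R * (h%:R + 2)) (- v) (- u) (N - h)) :> R.
Proof.
pose f (j k : nat) : R := ((j != k) &&
  (alpha * j.+1%:R ^+ 2 - alpha * k.+1%:R ^+ 2 \in itv_modZ u v))%:R.
rewrite cardsE -natr_card.
transitivity (\sum_(0 <= j < N) \sum_(0 <= k < N) f j k).
  rewrite big_mkord [RHS](eq_bigr (fun j : 'I_N => \sum_(k < N) f j k)).
    by rewrite pair_bigA /=; apply: eq_bigr => -[j k] _.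
  by move=> j _; rewrite big_mkord.
rewrite sum_offdiag; last by move=> j; rewrite /f eqxx.
apply: eq_big_nat => h /andP[h0 _]; rewrite /hits -big_split /=.
apply: eq_bigr => k _; rewrite /f -[X in (k + h)%N != X]addn0 eqn_add2l.
rewrite -[X in X != (k + h)%N]addn0 eqn_add2l [0 == h]eq_sym -lt0n h0 /=.
have xE : alpha * (k + h)%N.+1%:R ^+ 2 - alpha * k.+1%:R ^+ 2 =
    2 * alpha * h%:R * k%:R + alpha * h%:R * (h%:R + 2).
  by rewrite -!natr1 natrD; ring.
congr (_%:R + _%:R); first by rewrite xE.
by rewrite itv_modZN opprB xE.
Qed.

(** The main terms [2 (N - h) L] add up to [N (N - 1) L]. The [B] blocks of length [q] contain every
    [n] attached to some [h], [D] bounds the multiplicity of [n], and [H] bounds both harmonic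
    sums. *)
Lemma pair_error alpha u v L E D H (p : int) (N Q q B : nat) :
  1 <= E -> 0 < L <= 1 -> v - u = L -> (0 < Q)%N -> (0 < q)%N -> (0 < B)%N ->
  Q%:R * E <= N%:R <= 2 * E * Q%:R ->
  (forall (n : nat) (a : int), (0 < n)%N -> 2 * alpha * n%:R != a%:~R) ->
  coprimez p q -> `|q%:R * (2 * alpha) - p%:~R| <= q%:R^-1 ->
  N%:R * E / L < (B * q)%:R -> 0 <= D ->
  (forall n, (0 < n < B * q)%N -> (size (divisors n))%:R <= D) ->
  \sum_(1 <= m < B.+1) m%:R^-1 <= H -> \sum_(1 <= m < q.+1) m%:R^-1 <= H ->
  `|#|[set jk : 'I_N * 'I_N | (jk.1 != jk.2) &&
      (alpha * jk.1.+1%:R ^+ 2 - alpha * jk.2.+1%:R ^+ 2 \in itv_modZ u v)]%SET|%:R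
    - N%:R * (N%:R - 1) * L| <=
  2 * (N%:R * (4 * (N%:R * L / E) + 3 + 8 * E) +
    8 * E * (D * (5 * (N%:R + N%:R ^+ 2 / q%:R * H) + L * (B * q)%:R * (4 + 2 * H)))).
Proof.
move=> E1 L01 vuL Q0 q0 B0 QN irr cpq dq NB D0 divD HB Hq.
have [L0 _] := andP L01.
set S := N%:R * (4 * _ + _ + _) + _.
have half u' v' : v' - u' = L ->
    `|\sum_(1 <= h < N)
      (hits (2 * alpha * h%:R) (alpha * h%:R * (h%:R + 2)) u' v' (N - h)
       - (N - h)%:R * L)| <= S.
  move=> vuL'.
  have /choice[f fP] (h : nat) : exists n : nat, (0 < h < N)%N ->
      [/\ (h %| n)%N, (0 < n)%N, n%:R <= N%:R * E / L &
      `|hits (2 * alpha * h%:R) (alpha * h%:R * (h%:R + 2)) u' v' (N - h)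
        - (N - h)%:R * L| <=
      4 * (N%:R * L / E) + 3 +
      8 * E * (1 + small_denominator_weight (2 * alpha) L N q n)].
    have [hN|hN] := boolP (0 < h < N)%N; last by exists 0%N.
    have hN' : (0 < h <= N)%N by case/andP: hN => -> /ltnW.
    have [n nP] := hits_error_le_weight (alpha * h%:R * (h%:R + 2)) E1 L01 vuL' Q0 q0
      QN irr hN' (leq_subr h N).
    by exists n.
  apply: le_trans (ler_norm_sum _ _ _) _.
  apply: (@le_trans _ _ (\sum_(1 <= h < N) ((4 * (N%:R * L / E) + 3 + 8 * E) +
      8 * E * small_denominator_weight (2 * alpha) L N q (f h)))).
    apply: ler_sum_nat => h hN; have [_ _ _ le1] := fP h hN.
    by apply: le_trans le1 _; lra.
  have c0 : 0 <= 4 * (N%:R * L / E) + 3 + 8 * E.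
    have : 0 <= N%:R * L / E by rewrite !mulr_ge0 ?invr_ge0//; lra.
    lra.
  rewrite big_split /= sumr_const_nat -big_distrr /=; apply: lerD.
    by rewrite -[leLHS]mulr_natl ler_wpM2r// ler_nat leq_subr.
  apply: ler_wpM2l; first lra.
  apply: le_trans (sum_divisors_le (M := (B * q)%N) _ _ divD) _.
  - by move=> n; exact/weight_ge0/ltW.
  - move=> h hN; have [h1 h2 h3 _] := fP h hN; split => //.
    by rewrite h2 /= -(ltr_nat R); apply: le_lt_trans NB.
  apply: ler_wpM2l => //; apply: le_trans (sum_weight_le N (ltW L0) q0 B0 cpq dq) _.
  apply: lerD.
    by apply: ler_wpM2l => //; apply: lerD => //; apply: ler_wpM2l => //.
  apply: ler_wpM2l; first by rewrite mulr_ge0// ltW.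
  by lra.
have sumN : 2 * \sum_(1 <= h < N) (N - h)%:R = N%:R * (N%:R - 1) :> R.
  elim: (N) => [|n IH]; first by rewrite big_geq // mul0r mulr0.
  have -> : \sum_(1 <= h < n.+1) (n.+1 - h)%:R =
      \sum_(1 <= h < n.+1) ((n - h)%:R + 1) :> R.
    by apply: eq_big_nat => h /andP[_ hn]; rewrite subSn// natr1.
  rewrite big_split /= sumr_const_nat subn1 /= mulrDr -natr1.
  have -> : \sum_(1 <= h < n.+1) (n - h)%:R = \sum_(1 <= h < n) (n - h)%:R :> R.
    case: n {IH} => [|n]; first by rewrite !big_geq.
    by rewrite big_nat_recr//= subnn addr0.
  by rewrite IH; ring.
have vuL' : - u - - v = L by lra.
rewrite pair_count_hits big_split /= -sumN -mulrA big_distrl /=.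
have -> (X Y Z : R) : X + Y - 2 * Z = (X - Z) + (Y - Z) by ring.
rewrite -!sumrB; apply: le_trans (ler_normD _ _) _.
by have := half u v vuL; have := half (- v) (- u) vuL'; lra.
Qed.
End PairCount.

(** * Choice of the parameters *)

Section Asymptotics.
Context {R : realType}.
Implicit Types (alpha sigma kappa l c C N Y E L D H M q : R).

(** With [Y = N ^ sigma] and [E] a small power of [N], every term is [O(T)] for [T = N ^ 2 / (Y E)].
    The bounds on [Y E ^ 5], on [q] from below and on [q E ^ 4] control [N E ^ 4], [E ^ 3 N ^ 2 / q]
    and [E ^ 3 L q] respectively; [M] stands for [B q]. *)
Lemma error_budget N Y E l c C q L D H M :
  1 <= N -> 0 < Y -> 1 <= E -> 0 < l -> 0 < c -> 1 <= C -> 0 < q ->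
  Y * E ^+ 5 <= N -> c * (Y * E ^+ 6) <= q -> q * E ^+ 4 <= N ^+ 2 ->
  L = l / Y -> D = C * E -> H = C * E -> 0 <= M -> M <= N * E / L + q ->
  2 * (N * (4 * (N * L / E) + 3 + 8 * E) +
    8 * E * (D * (5 * (N + N ^+ 2 / q * H) + L * M * (4 + 2 * H)))) <=
  2 * (4 * l + 11 + 8 * (C * (5 + 5 * (C / c) + 6 * C * (1 + l)))) * (N ^+ 2 / (Y * E)).
Proof.
move=> N1 Y0 E1 l0 c0 C1 q0 YN cq qN LE DE HE M0 MB.
have E0 : 0 < E by lra.
have N0 : 0 < N by lra.
have L0 : 0 < L by rewrite LE divr_gt0.
set T := N ^+ 2 / (Y * E).
have T0 : 0 <= T by rewrite divr_ge0 ?sqr_ge0// mulr_ge0// ltW.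
have lT : N * (N * L / E) = l * T by rewrite LE /T; field; rewrite !gt_eqF.
have NE4 : N * E ^+ 4 <= T.
  rewrite /T ler_pdivlMr ?mulr_gt0//.
  have -> : N * E ^+ 4 * (Y * E) = N * (Y * E ^+ 5) by ring.
  by rewrite expr2 ler_pM2l.
have NEk k : (k <= 4)%N -> N * E ^+ k <= T.
  by move=> k4; apply: le_trans NE4; rewrite ler_pM2l// ler_weXn2l.
have NE0 := NEk 0%N isT; have NE1 := NEk 1%N isT; have NE2 := NEk 2%N isT.
rewrite expr0 mulr1 in NE0; rewrite expr1 in NE1.
have q1 : E ^+ 3 * (N ^+ 2 / q) <= T / c.
  rewrite mulrA ler_pdivrMr// [leRHS]mulrAC ler_pdivlMr//.
  apply: (@le_trans _ _ (T * (c * (Y * E ^+ 6)))); last by rewrite ler_wpM2l.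
  have -> : T * (c * (Y * E ^+ 6)) = E ^+ 5 * N ^+ 2 * c.
    by rewrite /T; field; rewrite !gt_eqF.
  by rewrite ler_pM2r// ler_pM2r ?exprn_gt0// ler_weXn2l.
have q2 : E ^+ 3 * (L * M) <= (1 + l) * T.
  apply: (@le_trans _ _ (E ^+ 3 * (L * (N * E / L + q)))).
    by rewrite ler_pM2l ?exprn_gt0// ler_pM2l.
  have -> : E ^+ 3 * (L * (N * E / L + q)) = N * E ^+ 4 + l * (E ^+ 3 * q / Y).
    by rewrite LE; field; rewrite !gt_eqF.
  rewrite mulrDl mul1r; apply: lerD => //; rewrite ler_pM2l//.
  rewrite ler_pdivrMr// /T; have -> : N ^+ 2 / (Y * E) * Y = N ^+ 2 / E.
    by field; rewrite !gt_eqF.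
  rewrite ler_pdivlMr//; apply: le_trans qN.
  by rewrite le_eqVlt; apply/orP; left; apply/eqP; ring.
have H6 : 4 + 2 * H <= 6 * C * E.
  have : 1 * 1 <= C * E by rewrite ler_pM.
  by rewrite HE; lra.
have LM0 : 0 <= L * M by rewrite mulr_ge0// ltW.
have C0 : 0 <= C by lra.
have t1 : E * (D * (L * M * (4 + 2 * H))) <= 6 * C ^+ 2 * ((1 + l) * T).
  apply: (@le_trans _ _ (E * (D * (L * M * (6 * C * E))))).
    by rewrite DE !ler_wpM2l ?mulr_ge0//; lra.
  have -> : E * (D * (L * M * (6 * C * E))) = 6 * C ^+ 2 * (E ^+ 3 * (L * M)).
    by rewrite DE; ring.
  by apply: ler_wpM2l => //; rewrite mulr_ge0// sqr_ge0.
have t2 : E * (D * (N ^+ 2 / q * H)) <= C ^+ 2 * (T / c).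
  have -> : E * (D * (N ^+ 2 / q * H)) = C ^+ 2 * (E ^+ 3 * (N ^+ 2 / q)).
    by rewrite DE HE; ring.
  by apply: ler_wpM2l => //; rewrite sqr_ge0.
have t3 : E * (D * N) <= C * T.
  have -> : E * (D * N) = C * (N * E ^+ 2) by rewrite DE; ring.
  exact: ler_wpM2l.
have -> : 2 * (4 * l + 11 + 8 * (C * (5 + 5 * (C / c) + 6 * C * (1 + l)))) * T =
  2 * (4 * (l * T) + 3 * T + 8 * T + 8 * (5 * (C * T) + 5 * (C ^+ 2 * (T / c)) +
   6 * C ^+ 2 * ((1 + l) * T))) by ring.
rewrite -lT.
have -> : 2 * (N * (4 * (N * L / E) + 3 + 8 * E) +
    8 * E * (D * (5 * (N + N ^+ 2 / q * H) + L * M * (4 + 2 * H)))) =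
  2 * (4 * (N * (N * L / E)) + 3 * N + 8 * (N * E) + 8 * (5 * (E * (D * N)) +
   5 * (E * (D * (N ^+ 2 / q * H))) + E * (D * (L * M * (4 + 2 * H))))) by ring.
by apply: ler_wpM2l => //; lra.
Qed.

(** Use the denominator [2 q]: [|2 alpha q - p| = 2 q |alpha - p / (2 q)|]. *)
Lemma diophantine_double kappa alpha : diophantine kappa alpha ->
  exists2 c : R, 0 < c & forall (p : int) (q : nat), (0 < q)%N ->
    c * (2 * q%:R) `^ (1 - kappa) <= `|q%:R * (2 * alpha) - p%:~R|.
Proof.
move=> [c c0 cP]; exists c => // p q q0.
have Q0 : 0 < 2 * q%:R :> R by rewrite mulr_gt0 ?ltr0n.
have := cP p (2 * q)%N; rewrite muln_gt0 /= natrM => /(_ q0).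
have -> : `|q%:R * (2 * alpha) - p%:~R| = 2 * q%:R * `|alpha - p%:~R / (2 * q%:R)|.
  rewrite -[X in X * `|_|](gtr0_norm Q0) -normrM; congr `|_|.
  by field; rewrite gt_eqF// ltr0n.
move=> h; rewrite powRD; last by apply/implyP => _; rewrite gt_eqF.
rewrite powRr1 ?(ltW Q0)// powRN mulrCA ler_pM2l//.
Qed.

(** A good approximation needs a large denominator: [c (2 q) ^ (1 - kappa) <= 2 x ^ (- (kappa - 1)
    s)] is solved for [q] by taking a root of order [kappa - 1]. *)
Lemma diophantine_denominator_ge kappa alpha : 2 <= kappa -> diophantine kappa alpha ->
  exists2 c : R, 0 < c & forall (p : int) (q : nat) (x s : R), (0 < q)%N ->
    0 < x -> `|q%:R * (2 * alpha) - p%:~R| <= 2 / x `^ ((kappa - 1) * s) ->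
    c * x `^ s <= q%:R.
Proof.
move=> k2 /diophantine_double[c c0 cP].
have k1 : 0 < kappa - 1 by lra.
exists (2^-1 * (c / 2) `^ (kappa - 1)^-1).
  by rewrite mulr_gt0// powR_gt0// divr_gt0.
move=> p q x s q0 x0 le1; have {}le1 := le_trans (cP p q q0) le1.
have Q0 : 0 < 2 * q%:R :> R by rewrite mulr_gt0 ?ltr0n.
have X0 : 0 < x `^ s by rewrite powR_gt0.
have Z0 : 0 < x `^ ((kappa - 1) * s) by rewrite powR_gt0.
have W0 : 0 < (2 * q%:R) `^ (kappa - 1) :> R by rewrite powR_gt0.
suff : (c / 2) `^ (kappa - 1)^-1 * x `^ s <= 2 * q%:R by lra.
have -> : (c / 2) `^ (kappa - 1)^-1 * x `^ s =
    (c / 2 * x `^ ((kappa - 1) * s)) `^ (kappa - 1)^-1.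
  rewrite [RHS]powRM ?(ltW Z0) ?divr_ge0 ?(ltW c0)//; congr (_ * _).
  by rewrite -powRrM mulrAC divff ?gt_eqF// mul1r.
have -> : 2 * q%:R = ((2 * q%:R) `^ (kappa - 1)) `^ (kappa - 1)^-1 :> R.
  by rewrite -powRrM divff ?gt_eqF// powRr1// ltW.
apply: ge0_ler_powR; rewrite ?invr_ge0 ?(ltW k1) ?nnegrE ?(ltW W0)//.
  by rewrite mulr_ge0 ?(ltW Z0)// divr_ge0// ltW.
rewrite -opprB powRN ler_pdivlMr// mulrAC ler_pdivrMr// in le1.
lra.
Qed.

(** The first inequality yields [N ^ (sigma + 5 e) <= N]; the second lets approximation at level
    [N ^ (2 - 4 e)] force [q >> N ^ (sigma + 6 e)]. Both have room at [e = 0]. *)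
Lemma exists_exponent sigma kappa : 0 <= sigma -> sigma < 1 -> 2 <= kappa ->
  (0 < sigma -> kappa < 1 + 2 / sigma) ->
  exists2 e : R, 0 < e & 5 * e <= 1 - sigma /\
    (kappa - 1) * (sigma + 6 * e) <= 2 - 4 * e.
Proof.
move=> s0 s1 k2 ks.
have t0 : (kappa - 1) * sigma < 2.
  have [s0'|s0'] := ltP 0 sigma.
    by rewrite -ltr_pdivlMr//; have := ks s0'; lra.
  by rewrite (_ : sigma = 0) ?mulr0//; apply/le_anti; rewrite s0 s0'.
(* [d] is the coefficient of [e] in [(kappa - 1) (sigma + 6 e) + 4 e <= 2]. *)
pose d := 4 + 6 * (kappa - 1).
have d0 : 0 < d by rewrite /d; lra.
exists (Num.min ((1 - sigma) / 5) ((2 - (kappa - 1) * sigma) / d)).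
  by rewrite lt_min !divr_gt0//; lra.
set e := Num.min _ _.
have e1 : e <= (1 - sigma) / 5 by rewrite ge_min lexx.
have : e <= (2 - (kappa - 1) * sigma) / d by rewrite ge_min lexx orbT.
by rewrite ler_pdivlMr// /d => e2; split; lra.
Qed.

End Asymptotics.

(** * Convergence with a power saving *)

Section Rate.
Context {R : realType}.
Implicit Types (sigma kappa alpha a b : R).

Lemma truncn_bounds (y : R) : 1 <= y ->
  (0 < Num.truncn y)%N /\ (Num.truncn y)%:R <= y <= 2 * (Num.truncn y)%:R.
Proof.
move=> y1; have y0 : 0 <= y by lra.
have /andP[t0 t1] := truncn_itv y0.
have tp : (0 < Num.truncn y)%N by rewrite truncn_gt0.
have t1' : 1 <= (Num.truncn y)%:R :> R by rewrite ler1n.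
by rewrite -natr1 in t1; split => //; apply/andP; split; lra.
Qed.

Lemma near_le_powR (r s : R) : 0 < s -> \forall N \near \oo, r <= N%:R `^ s.
Proof.
move=> s0; pose r1 := Num.max r 0; have r10 : 0 <= r1 by rewrite le_max lexx orbT.
have := nbhs_infty_ger (r1 `^ s^-1); apply: filterS => N rN.
apply: (@le_trans _ _ r1); first by rewrite le_max lexx.
have -> : r1 = (r1 `^ s^-1) `^ s by rewrite -powRrM mulVf ?gt_eqF// powRr1.
by apply: ge0_ler_powR; rewrite ?nnegrE ?powR_ge0 ?(ltW s0).
Qed.

Lemma R2_rate sigma kappa alpha a b : 0 <= sigma -> sigma < 1 -> 2 <= kappa ->
  (0 < sigma -> kappa < 1 + 2 / sigma) -> diophantine kappa alpha ->
  a < b -> (sigma = 0 -> b - a <= 1) ->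
  exists e K : R, 0 < e /\ \forall N \near \oo,
    `|R2 sigma a b (fun n => alpha * n%:R ^+ 2) N - (b - a)| <= K * (N%:R `^ e)^-1.
Proof.
move=> s0 s1 k2 ks dioph ab sig0.
have [e e0 [e5 ek]] := exists_exponent s0 s1 k2 ks.
have e1 : e <= 1 by lra.
have e24 : 0 <= 2 - 4 * e by lra.
have e244 : 2 - 4 * e <= 4 by lra.
have se5 : sigma + e * 5 <= 1 by lra.
have se4 : 1 + e + sigma <= 4 by lra.
have [c c0 cP] := diophantine_denominator_ge k2 dioph.
have [c' c'0 c'P] := diophantine_double dioph.
have irr (n : nat) (p : int) : (0 < n)%N -> 2 * alpha * n%:R != p%:~R.
  move=> n0; rewrite mulrC -subr_eq0 -normr_gt0; apply: lt_le_trans (c'P p n n0).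
  by rewrite mulr_gt0// powR_gt0// mulr_gt0 ?ltr0n.
(* Divisor and harmonic bounds are applied up to [B q <= C1 N ^ 4], so the exponent [e / 4] costs
   [O(N ^ e)]. *)
have e4 : 0 < e / 4 by rewrite divr_gt0.
have [CD CD0 divb] := divisor_bound e4.
pose l := b - a; have l0 : 0 < l by rewrite subr_gt0.
(* [N E / L = N ^ (1 + e + sigma) / l] and [q] are at most [N ^ 4 / l] and [N ^ 4]. *)
pose C1 := l^-1 + 1; have C10 : 0 < C1 by rewrite addr_gt0 ?invr_gt0.
pose C2 := C1 `^ (e / 4); have C20 : 0 < C2 by rewrite powR_gt0.
pose CH := 1 + (e / 4)^-1; have CH0 : 0 < CH by rewrite addr_gt0 ?invr_gt0.
pose C := CD * C2 + CH * C2 + 1.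
have CDC : CD * C2 <= C by rewrite /C -addrA lerDl addr_ge0// mulr_ge0// ltW.
have CHC : CH * C2 <= C.
  by rewrite /C -addrA [CH * C2 + 1]addrC addrA lerDr addr_ge0// mulr_ge0// ltW.
have C11 : 1 <= C by rewrite /C lerDr addr_ge0// mulr_ge0// ltW.
pose K0 := 2 * (4 * l + 11 + 8 * (C * (5 + 5 * (C / c) + 6 * C * (1 + l)))).
exists e, (K0 + l); split=> //.
(* This is [L <= 1]: the arc does not wrap around the circle. For [sigma = 0] it is the restriction
   [b - a <= 1]. *)
have near_l : \forall N \near \oo, l <= N%:R `^ sigma.
  have [sp|sn] := ltP 0 sigma; first exact: near_le_powR.
  have sE : sigma = 0 by apply/le_anti; rewrite s0 sn.
  by apply: nearW => N; rewrite sE powRr0; exact: sig0.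
have near_1 : \forall N \near \oo, (1 <= N)%N by exact: nbhs_infty_ge.
clearbody C.
near=> N.
have N1 : (1 <= N)%N by near: N.
have lY : l <= N%:R `^ sigma by near: N.
pose x : R := N%:R; have x1 : 1 <= x by rewrite ler1n.
have x0 : 0 < x by exact: lt_le_trans ltr01 x1.
have xD r s : x `^ (r + s) = x `^ r * x `^ s.
  by rewrite powRD// (gt_eqF x0) implybT.
have x_le r s : r <= s -> x `^ r <= x `^ s by move=> rs; apply: ler_powR.
have x_ge1 r : 0 <= r -> 1 <= x `^ r by move=> r0; have := x_le 0 r r0; rewrite powRr0.
pose Y := x `^ sigma; pose E := x `^ e; pose L := l / Y.
have Y0 : 0 < Y by rewrite powR_gt0.
have E1 : 1 <= E by apply: x_ge1; apply: ltW.
have E0 : 0 < E by exact: lt_le_trans ltr01 E1.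
have EX k : E ^+ k = x `^ (e * k%:R) by rewrite -powR_mulrn ?powR_ge0// -powRrM.
have xE : x = x `^ 1 by rewrite powRr1// ltW.
have Ex : E <= x by rewrite [leRHS]xE x_le.
have L0 : 0 < L by rewrite divr_gt0.
have L1 : L <= 1 by rewrite ler_pdivrMr// mul1r.
have xE1 : 1 <= x / E by rewrite ler_pdivlMr// mul1r.
have [Q0 /andP[Qlo Qhi]] := truncn_bounds xE1.
move: (Num.truncn _) Q0 Qlo Qhi => Q Q0 Qlo Qhi.
rewrite ler_pdivlMr// in Qlo; rewrite ler_pdivrMr// in Qhi.
have x24 : 1 <= x `^ (2 - 4 * e) by exact: x_ge1.
have [Qd0 /andP[Qdlo Qdhi]] := truncn_bounds x24.
have [p [q [/andP[q0 qQd] cpq dq]]] := dirichlet_approx (2 * alpha) Qd0.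
move: (Num.truncn _) Qd0 Qdlo Qdhi qQd dq => Qd Qd0 Qdlo Qdhi qQd dq.
have q0' : 0 < q%:R :> R by rewrite ltr0n.
have Qd0' : 0 < Qd%:R :> R by rewrite ltr0n.
have dq' : `|q%:R * (2 * alpha) - p%:~R| <= q%:R^-1.
  by apply: le_trans dq _; rewrite lef_pV2 ?posrE// ler_nat.
have q_le : q%:R <= x `^ (2 - 4 * e) by apply: le_trans Qdlo; rewrite ler_nat.
(* The error is at most [1 / Qd <= 2 / x ^ (2 - 4 e)], small enough by the choice of [e]. *)
have q_ge : c * x `^ (sigma + 6 * e) <= q%:R.
  apply: (cP p) => //; apply: le_trans dq _.
  rewrite -[leRHS]invrK lef_pV2 ?posrE ?invr_gt0 ?divr_gt0 ?powR_gt0//.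
  rewrite invf_div ler_pdivrMr// [leRHS]mulrC; apply: le_trans Qdhi; exact: x_le.
have XL0 : 0 <= x * E / L / q%:R.
  by rewrite divr_ge0 ?ler0n// divr_ge0 ?(ltW L0)// mulr_ge0 ?(ltW x0) ?(ltW E0).
(* [B = B' + 1] is the least number of blocks with [B q > N E / L], so [B q <= N E / L + q]. *)
have /andP[B1 B2] := truncn_itv XL0.
move: (Num.truncn _) B1 B2 => B' B1 B2; pose B := B'.+1.
rewrite ler_pdivlMr// in B1; rewrite ltr_pdivrMr// -natrM in B2.
have Mle : (B * q)%:R <= x * E / L + q%:R by rewrite mulSn natrD natrM addrC lerD2r.
have Mx : (B * q)%:R <= C1 * x `^ 4.
  apply: le_trans Mle _; rewrite mulrDl mul1r; apply: lerD.
    rewrite /L invf_div mulrA ler_pdivrMr//.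
    have -> : l^-1 * x `^ 4 * l = x `^ 4 by rewrite mulrAC mulVf ?mul1r// gt_eqF.
    rewrite [x in x * E]xE -!xD; exact: x_le.
  by apply: le_trans q_le _; exact: x_le.
have Me (n : nat) : (n <= B * q)%N -> n%:R `^ (e / 4) <= C2 * E.
  move=> nM; apply: (@le_trans _ _ ((C1 * x `^ 4) `^ (e / 4))).
    apply: ge0_ler_powR; rewrite ?(ltW e4) ?nnegrE ?ler0n//.
      by rewrite mulr_ge0 ?(ltW C10) ?powR_ge0.
    by apply: le_trans Mx; rewrite ler_nat.
  rewrite powRM ?powR_ge0 ?(ltW C10)// -powRrM.
  by rewrite (_ : 4 * (e / 4) = e) //; field.
have Bq0 : (0 < B * q)%N by rewrite muln_gt0.
have harm (n : nat) : (0 < n <= B * q)%N ->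
    \sum_(1 <= m < n.+1) m%:R^-1 <= C * E.
  move=> /andP[n0 nM]; apply: le_trans (harmonic_sum_le e4 n0) _.
  apply: (@le_trans _ _ (CH * (C2 * E))); first by rewrite ler_pM2l// Me.
  by rewrite mulrA ler_pM2r.
have QN : Q%:R * E <= N%:R <= 2 * E * Q%:R by rewrite Qlo/= mulrAC.
have L01 : 0 < L <= 1 by rewrite L0.
have CE0 : 0 <= C * E by rewrite mulr_ge0 ?(le_trans ler01 C11) ?(ltW E0).
have divD (n : nat) : (0 < n < B * q)%N -> (size (divisors n))%:R <= C * E.
  move=> /andP[n0 nM]; apply: le_trans (divb n n0) _.
  apply: (@le_trans _ _ (CD * (C2 * E))); first by rewrite ler_pM2l// Me// ltnW.
  by rewrite mulrA ler_pM2r.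
have HB : \sum_(1 <= m < B.+1) m%:R^-1 <= C * E by apply: harm; rewrite /= leq_pmulr.
have Hq : \sum_(1 <= m < q.+1) m%:R^-1 <= C * E by apply: harm; rewrite q0 leq_pmull.
have vuL : b / Y - a / Y = L by rewrite -mulrBl.
have pe := pair_error E1 L01 vuL Q0 q0 (ltn0Sn B') QN irr cpq dq' B2 CE0 divD HB Hq.
have YE5 : Y * E ^+ 5 <= x by rewrite [leRHS]xE EX -xD; exact: x_le.
have YE6 : c * (Y * E ^+ 6) <= q%:R by rewrite EX -xD [e * 6]mulrC.
have qE4 : q%:R * E ^+ 4 <= x ^+ 2.
  rewrite -[leRHS]powR_mulrn ?(ltW x0)// [leRHS](_ : _ = x `^ (2 - 4 * e) * E ^+ 4).
    by rewrite ler_wpM2r// exprn_ge0// ltW.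
  by rewrite EX -xD [e * 4]mulrC subrK.
have eb := error_budget x1 Y0 E1 l0 c0 C11 q0' YE5 YE6 qE4 (erefl L) (erefl (C * E))
  (erefl (C * E)) (ler0n R (B * q)) Mle.
have {pe}eb := le_trans pe eb.
rewrite /R2 /pair_count /= -/x -/Y -/l; move: eb.
set cnt := (#|_|%:R : R); rewrite -/x -/K0 => eb.
have x2s : x `^ (2 - sigma) = x ^+ 2 / Y.
  by rewrite xD powRN powR_mulrn ?(ltW x0).
(* The main term [N (N - 1) L] lacks the [N] diagonal pairs, which costs [l / N]. *)
have -> : (x `^ (2 - sigma))^-1 * cnt - l =
    Y / x ^+ 2 * (cnt - x * (x - 1) * L) - l / x.
  by rewrite x2s /L; field; rewrite !gt_eqF.
apply: le_trans (ler_normB _ _) _; rewrite [leRHS]mulrDl; apply: lerD.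
  have Yx2 : 0 < Y / x ^+ 2 by rewrite divr_gt0// exprn_gt0.
  rewrite normrM gtr0_norm//; apply: le_trans (ler_wpM2l (ltW Yx2) eb) _.
  rewrite le_eqVlt; apply/orP; left; apply/eqP; rewrite -/x -/E; clearbody K0.
  by field; rewrite !gt_eqF.
rewrite gtr0_norm ?divr_gt0// ler_pM2l// lef_pV2 ?posrE//.
Unshelve. all: by end_near. Qed.

Lemma R2_ge0 sigma a b (theta : nat -> R) N : 0 <= R2 sigma a b theta N.
Proof. by rewrite mulr_ge0// invr_ge0 powR_ge0. Qed.

Lemma R2_monotone sigma a b b' (theta : nat -> R) N : b <= b' ->
  R2 sigma a b theta N <= R2 sigma a b' theta N.
Proof.
move=> bb'; apply: ler_wpM2l; first by rewrite invr_ge0 powR_ge0.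
rewrite ler_nat; apply/subset_leq_card/fintype.subsetP => jk; rewrite !inE.
move=> /andP[-> /itv_modZP[m /andP[h1 h2]]]; apply/itv_modZP; exists m.
by rewrite h1 /=; apply: le_trans h2 _; rewrite ler_wpM2r// invr_ge0 powR_ge0.
Qed.

Lemma R2_cvg sigma kappa alpha a b : 0 <= sigma -> sigma < 1 -> 2 <= kappa ->
  (0 < sigma -> kappa < 1 + 2 / sigma) -> diophantine kappa alpha ->
  a < b -> (sigma = 0 -> b - a <= 1) ->
  R2 sigma a b (fun n => alpha * n%:R ^+ 2) N @[N --> \oo] --> b - a.
Proof.
move=> s0 s1 k2 ks dioph ab sig0.
have [e [K [e0 rate]]] := R2_rate s0 s1 k2 ks dioph ab sig0.
apply/cvgrPdist_le => eps eps0.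
have big := near_le_powR (Num.max 1 (K / eps)) e0.
near=> N.
have h1 : `|R2 sigma a b (fun n => alpha * n%:R ^+ 2) N - (b - a)|
    <= K * (N%:R `^ e)^-1 by near: N.
have : Num.max 1 (K / eps) <= N%:R `^ e by near: N.
rewrite ge_max => /andP[h2 h3].
rewrite distrC; apply: le_trans h1 _.
by rewrite ler_pdivrMr ?(lt_le_trans _ h2)// mulrC -ler_pdivrMr.
Unshelve. all: by end_near. Qed.

End Rate.

Theorem theorem1 (R : realType) (sigma kappa alpha : R)
  (sigma_ge0 : 0 <= sigma) (sigma_lt1 : sigma < 1)
  (kappa_ge2 : 2 <= kappa)
  (* for sigma = 0 the upper bound on kappa is +oo *)
  (kappa_lt : 0 < sigma -> kappa < 1 + 2 / sigma)
  (alpha_dioph : diophantine kappa alpha) :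
  exhibits_pair_correlation sigma (fun n : nat => alpha * n%:R ^+ 2).
Proof.
move=> a b; rewrite le_eqVlt => /orP[/eqP <- _|ab sig0]; last first.
  exact: R2_cvg kappa_lt _ _ _.
rewrite subrr; apply/cvgrPdist_le => eps eps0.
(* For [a = b], enlarge the interval to [[a, a + eta]], whose limit [eta] is at most [eps / 2];
   [eta <= 1] keeps it admissible for [sigma = 0]. *)
pose eta := Num.min (eps / 2) 1.
have eta0 : 0 < eta by rewrite lt_min divr_gt0//=.
have e2 : 0 < eps / 2 by rewrite divr_gt0.
have eta1 : eta <= eps / 2 by rewrite ge_min lexx.
have eta2 : eta <= 1 by rewrite ge_min lexx orbT.
have aeta : a < a + eta by rewrite ltrDl.
have etaE : a + eta - a = eta by rewrite addrAC subrr add0r.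
have sig_eta : sigma = 0 -> a + eta - a <= 1 by rewrite etaE.
have := R2_cvg sigma_ge0 sigma_lt1 kappa_ge2 kappa_lt alpha_dioph aeta sig_eta.
rewrite etaE => /cvgrPdist_le/(_ _ e2).
apply: filterS => N; rewrite ler_norml => /andP[h _].
rewrite sub0r normrN ger0_norm ?R2_ge0//.
apply: le_trans (R2_monotone sigma a (b' := a + eta) _ N _) _.
  by rewrite lerDl ltW.
lra.
Qed.
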